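(* Let $(V_1, V_2)$ be a compact normal pair on $\mathcal{H}$ and $k := \dim E_1 \in \{0,1,\dots\}\cup\{\infty\}$. Then there exists an orthonormal basis $\{f_i\}_{i=1}^k$ of $E_1$ consisting of eigenvectors of $[V_2^*, V_1]$ such that, setting $\mathcal{H}_j := \overline{\operatorname{span}}\{V_1^m V_2^n f_j: m, n \geq 0\}$ for $1\le j\le k$ and $\mathcal{H}_0 := \mathcal{H}\ominus\bigoplus_{j=1}^k\mathcal{H}_j$: (1) each $\mathcal{H}_j$ ($0\le j\le k$) is a closed $(V_1,V_2)$-reducing subspace and $\mathcal{H} = \bigoplus_{j=0}^k \mathcal{H}_j$ (orthogonal sum); (2) for $1\le i\le k$, the pair $(V_{1,i}, V_{2,i}) := (V_1|_{\mathcal{H}_i}, V_2|_{\mathcal{H}_i})$ is irreducible; (3) $(V_{1,0}, V_{2,0}) := (V_1|_{\mathcal{H}_0}, V_2|_{\mathcal{H}_0})$ is a shift-unitary pair.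
   Context: All Hilbert spaces are complex and separable. An isometric pair is a pair $(V_1,V_2)$ of commuting isometries on $\mathcal{H}$. An isometry $V$ is a shift if $V^{*m}\to0$ strongly. A BCL pair is an isometric pair with $V_1V_2$ a shift. $[V_2^*,V_1] := V_2^*V_1 - V_1V_2^*$. A compact normal pair is a BCL pair with $[V_2^*,V_1]$ compact and normal. $C(V_1,V_2) := I - V_1V_1^* - V_2V_2^* + V_1V_2V_1^*V_2^*$ and $E_1 := \ker(C(V_1,V_2)-I)$. A subspace is $(V_1,V_2)$-reducing if invariant under $V_1,V_2,V_1^*,V_2^*$; a pair is irreducible if its only reducing subspaces are $\{0\}$ and the whole space. A shift-unitary pair is an isometric pair $(W_1,W_2)$ on $\mathcal{K}$ with $[W_2^*,W_1]=0$ such that $\mathcal{K}=\mathcal{K}_{us}\oplus\mathcal{K}_{su}$ with both summands reducing, $W_1$ unitary and $W_2$ a shift on $\mathcal{K}_{us}$, $W_1$ a shift and $W_2$ unitary on $\mathcal{K}_{su}$ (summands may be zero). *)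

(* Defs.v *)
From HB Require Import structures.
From mathcomp Require Import all_boot all_order all_algebra.
From mathcomp Require Import reals.
From mathcomp Require Import complex.
Set Implicit Arguments. Unset Strict Implicit. Unset Printing Implicit Defensive.
Import Order.TTheory GRing.Theory Num.Theory.
Local Open Scope ring_scope.

Section Hilbert.
Variables (R : realType) (H : lmodType R[i]) (ip : H -> H -> R[i]).

Definition hnorm (x : H) : R := Num.sqrt (complex.Re (ip x x)).

Definition inner_product : Prop :=
  [/\ (forall (a : R[i]) (x y z : H), ip (a *: x + y) z = a * ip x z + ip y z),
      (forall x y : H, ip y x = conjc (ip x y)),
      (forall x : H, 0 <= ip x x) &
      (forall x : H, ip x x = 0 -> x = 0)].

Definition hcvg (u : nat -> H) (l : H) : Prop :=
  forall e : R, 0 < e -> exists N : nat, forall n, (N <= n)%N -> hnorm (u n - l) < e.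

Definition hcauchy (u : nat -> H) : Prop :=
  forall e : R, 0 < e -> exists N : nat,
    forall m n, (N <= m)%N -> (N <= n)%N -> hnorm (u m - u n) < e.

Definition hilbert_space : Prop :=
  [/\ inner_product,
      (forall u, hcauchy u -> exists l, hcvg u l) &
      (exists d : nat -> H, forall (x : H) (e : R), 0 < e -> exists n, hnorm (x - d n) < e)].

Definition hlinear (T : H -> H) : Prop :=
  forall (a : R[i]) (x y : H), T (a *: x + y) = a *: T x + T y.

Definition bounded_op (T : H -> H) : Prop :=
  hlinear T /\ exists M : R, forall x, hnorm (T x) <= M * hnorm x.

Definition is_adjoint (T Ts : H -> H) : Prop :=
  forall x y : H, ip (T x) y = ip x (Ts y).

Definition isometry (V : H -> H) : Prop :=
  hlinear V /\ forall x, hnorm (V x) = hnorm x.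

(* V is a shift, expressed through its adjoint Vs: V^{*m} -> 0 strongly *)
Definition shift_adj (Vs : H -> H) : Prop :=
  forall x : H, hcvg (fun m => iter m Vs x) 0.

Definition compact_op (T : H -> H) : Prop :=
  bounded_op T /\
  forall u : nat -> H, (exists M : R, forall n, hnorm (u n) <= M) ->
    exists (phi : nat -> nat) (l : H),
      (forall n, (phi n < phi n.+1)%N) /\ hcvg (fun n => T (u (phi n))) l.

Definition normal_op (T : H -> H) : Prop :=
  exists Ts : H -> H, is_adjoint T Ts /\ forall x, T (Ts x) = Ts (T x).

Definition commutator (V1 V2s : H -> H) : H -> H :=
  fun x => V2s (V1 x) - V1 (V2s x).

(* BCL pair, given the adjoints V1s, V2s of V1, V2 *)
Definition BCL_pair (V1 V2 V1s V2s : H -> H) : Prop :=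
  [/\ isometry V1, isometry V2, (forall x, V1 (V2 x) = V2 (V1 x)) &
      shift_adj (fun x => V2s (V1s x))].

Definition compact_normal_pair (V1 V2 V1s V2s : H -> H) : Prop :=
  [/\ BCL_pair V1 V2 V1s V2s, compact_op (commutator V1 V2s) &
      normal_op (commutator V1 V2s)].

Definition defect_op (V1 V2 V1s V2s : H -> H) : H -> H :=
  fun x => x - V1 (V1s x) - V2 (V2s x) + V1 (V2 (V1s (V2s x))).

Definition E1 (V1 V2 V1s V2s : H -> H) : H -> Prop :=
  fun x => defect_op V1 V2 V1s V2s x = x.

Definition subspace (M : H -> Prop) : Prop :=
  [/\ M 0, (forall x y, M x -> M y -> M (x + y)) &
      (forall (a : R[i]) x, M x -> M (a *: x))].

Definition closed_set (M : H -> Prop) : Prop :=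
  forall (u : nat -> H) (l : H), (forall n, M (u n)) -> hcvg u l -> M l.

Definition closed_subspace (M : H -> Prop) : Prop := subspace M /\ closed_set M.

Definition hspan (S : H -> Prop) : H -> Prop :=
  fun x => exists (n : nat) (c : nat -> R[i]) (v : nat -> H),
    (forall i, (i < n)%N -> S (v i)) /\ x = \sum_(i < n) c i *: v i.

Definition cspan (S : H -> Prop) : H -> Prop :=
  fun x => forall e : R, 0 < e -> exists y, hspan S y /\ hnorm (x - y) < e.

Definition horth (M N : H -> Prop) : Prop :=
  forall x y, M x -> N y -> ip x y = 0.

Definition orth_compl (M : H -> Prop) : H -> Prop :=
  fun x => forall y, M y -> ip x y = 0.

Definition orthonormal_basis (J : nat -> Prop) (f : nat -> H) (E : H -> Prop) : Prop :=
  [/\ (forall i, J i -> E (f i)),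
      (forall i j, J i -> J j -> ip (f i) (f j) = (i == j)%:R) &
      (forall x, E x <-> cspan (fun y => exists i, J i /\ y = f i) x)].

Definition invariant (T : H -> H) (M : H -> Prop) : Prop :=
  forall x, M x -> M (T x).

Definition reducing (V1 V2 V1s V2s : H -> H) (M : H -> Prop) : Prop :=
  [/\ invariant V1 M, invariant V2 M, invariant V1s M & invariant V2s M].

(* the restriction of (V1,V2) to the closed reducing subspace M is irreducible
   (the adjoints of the restrictions are the restrictions of V1s, V2s) *)
Definition irreducible_on (V1 V2 V1s V2s : H -> H) (M : H -> Prop) : Prop :=
  forall N : H -> Prop, closed_subspace N -> (forall x, N x -> M x) ->
    reducing V1 V2 V1s V2s N ->
    (forall x, N x -> x = 0) \/ (forall x, M x -> N x).

Definition shift_unitary_on (V1 V2 V1s V2s : H -> H) (M : H -> Prop) : Prop :=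
  (forall x, M x -> V2s (V1 x) = V1 (V2s x)) /\
  exists Kus Ksu : H -> Prop,
    [/\ closed_subspace Kus, closed_subspace Ksu,
        (forall x, Kus x -> M x), (forall x, Ksu x -> M x) &
        horth Kus Ksu] /\
    (forall x, M x -> exists y z, [/\ Kus y, Ksu z & x = y + z]) /\
    (reducing V1 V2 V1s V2s Kus /\ reducing V1 V2 V1s V2s Ksu) /\
    [/\ (forall y, Kus y -> exists x, Kus x /\ V1 x = y),
        (forall x, Kus x -> hcvg (fun m => iter m V2s x) 0),
        (forall y, Ksu y -> exists x, Ksu x /\ V2 x = y) &
        (forall x, Ksu x -> hcvg (fun m => iter m V1s x) 0)].

End Hilbert.

(* Main.v *)
(* Put X = [V2^*, V1]. Always X V2 = 0 and V1^* X = 0, and normality upgrades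
   this to: X and X^* vanish on the ranges of V1 and V2 and take values in
   E1 = ker V1^* /\ ker V2^*. The spectral theorem for the compact normal
   operator X on E1 gives the eigenbasis f_i. From V1^* V2 = V2 V1^* + X^* one
   gets V1^* V2^(n+1) f_i = conj(lam_i) V2^n f_i, so H_i is reducing; the H_i
   are orthogonal because f_j is killed by V1^* and V2^*, and H_i is irreducible
   because E1 /\ H_i is the line of f_i. On H_0 no vector of E1 is left, so X = 0
   there: the restricted pair is doubly commuting with
   ker V1^* /\ ker V2^* = 0. Splitting H_0 into the unitary part of V1 and its
   complement, on which V2 is unitary, gives the shift-unitary structure. *)
Require Import Defs.
From HB Require Import structures.
From mathcomp Require Import all_boot all_order all_algebra.
From mathcomp Require Import boolp classical_sets.
From mathcomp Require Import reals.
From mathcomp Require Import complex.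
From mathcomp Require Import ring lra.
Import Order.TTheory GRing.Theory Num.Theory.
Local Open Scope ring_scope.
Set Implicit Arguments. Unset Strict Implicit. Unset Printing Implicit Defensive.

(** * Inner product, norm and the Cauchy-Schwarz inequality *)

Section InnerProduct.
Variables (R : realType) (H : lmodType R[i]) (ip : H -> H -> R[i]).
Hypothesis hip : inner_product ip.
Implicit Types (x y z : H) (a : R[i]) (r : R).

(** The underlying real inner product: a symmetric form with values in the ordered field [R], so
    that norm estimates become goals for [ring] and [lra]. *)
Definition rip x y : R := complex.Re (ip x y).

Lemma ipC x y : ip y x = conjc (ip x y).
Proof. by case: hip. Qed.

Lemma ipDl x y z : ip (x + y) z = ip x z + ip y z.
Proof. by case: hip => h _ _ _; rewrite -[x]scale1r h mul1r scale1r. Qed.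

Lemma ip0l z : ip 0 z = 0.
Proof. by apply: (addrI (ip 0 z)); rewrite -ipDl !addr0. Qed.

Lemma ipZl a x z : ip (a *: x) z = a * ip x z.
Proof. by case: hip => h _ _ _; rewrite -[_ *: _]addr0 h ip0l addr0. Qed.

Lemma ipNl x z : ip (- x) z = - ip x z.
Proof. by rewrite -scaleN1r ipZl mulN1r. Qed.

Lemma ipBl x y z : ip (x - y) z = ip x z - ip y z.
Proof. by rewrite ipDl ipNl. Qed.

Lemma ipDr x y z : ip z (x + y) = ip z x + ip z y.
Proof. by rewrite ipC ipDl rmorphD /= -!ipC. Qed.

Lemma ip0r z : ip z 0 = 0.
Proof. by rewrite ipC ip0l conjc0. Qed.

Lemma ipZr a x z : ip z (a *: x) = conjc a * ip z x.
Proof. by rewrite ipC ipZl rmorphM /= -!ipC. Qed.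

Lemma ipNr x z : ip z (- x) = - ip z x.
Proof. by rewrite ipC ipNl rmorphN /= -ipC. Qed.

Lemma ipBr x y z : ip z (x - y) = ip z x - ip z y.
Proof. by rewrite ipDr ipNr. Qed.

Lemma ip_eq0C x y : ip x y = 0 -> ip y x = 0.
Proof. by rewrite (ipC x y) => ->; rewrite conjc0. Qed.

Lemma ip_inj x y : (forall z, ip x z = ip y z) -> x = y.
Proof.
move=> h; case: hip => _ _ _ d; apply/eqP; rewrite -subr_eq0; apply/eqP/d.
by rewrite ipBl h subrr.
Qed.

Lemma ipxx x : ip x x = (rip x x)%:C%C.
Proof.
case: hip => _ _ p _; rewrite [LHS]complexE (ger0_Im (p x)) /rip.
by rewrite [X in _ + _ * X](_ : _ = 0) // mulr0 addr0.
Qed.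

Lemma ripC x y : rip y x = rip x y.
Proof. by rewrite /rip ipC; case: (ip x y). Qed.

Lemma ripDl x y z : rip (x + y) z = rip x z + rip y z.
Proof. by rewrite /rip ipDl; case: (ip x z); case: (ip y z). Qed.

Lemma ripDr x y z : rip z (x + y) = rip z x + rip z y.
Proof. by rewrite ripC ripDl !(ripC z). Qed.

Lemma ripZl r x z : rip (r%:C%C *: x) z = r * rip x z.
Proof. by rewrite /rip ipZl; case: (ip x z) => b c /=; rewrite mul0r subr0. Qed.

Lemma ripZr r x z : rip z (r%:C%C *: x) = r * rip z x.
Proof. by rewrite ripC ripZl ripC. Qed.

Lemma ripNl x z : rip (- x) z = - rip x z.
Proof. by rewrite /rip ipNl; case: (ip x z). Qed.

Lemma ripNr x z : rip z (- x) = - rip z x.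
Proof. by rewrite ripC ripNl ripC. Qed.

Definition ripE := (ripDl, ripDr, ripNl, ripNr, ripZl, ripZr).

Lemma ripxx_ge0 x : 0 <= rip x x.
Proof. by case: hip => _ _ p _; have := p x; rewrite ipxx ler0c. Qed.

Lemma ripxx_eq0 x : rip x x = 0 -> x = 0.
Proof. by case: hip => _ _ _ d h; apply: d; rewrite ipxx h. Qed.

Lemma ipxx_eq0 x : ip x x = 0 -> x = 0.
Proof. by case: hip => _ _ _ d /d. Qed.

Lemma rip_Im x y : complex.Im (ip x y) = - rip ('i%C *: x) y.
Proof.
by rewrite /rip ipZl; case: (ip x y) => a b /=; rewrite mul0r mul1r sub0r opprK.
Qed.

Lemma hnorm_ge0 x : 0 <= hnorm ip x.
Proof. exact: sqrtr_ge0. Qed.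

Lemma hnorm_sqr x : hnorm ip x ^+ 2 = rip x x.
Proof. by rewrite sqr_sqrtr ?ripxx_ge0. Qed.

Lemma hnorm_eq0 x : hnorm ip x = 0 -> x = 0.
Proof. by move=> h; apply: ripxx_eq0; rewrite -hnorm_sqr h expr0n. Qed.

Lemma hnorm0 : hnorm ip 0 = 0.
Proof. by rewrite /hnorm ip0l sqrtr0. Qed.

Lemma hnorm_lt x r : 0 < r -> (hnorm ip x < r) = (rip x x < r ^+ 2).
Proof. by move=> r0; rewrite -hnorm_sqr ltr_pXn2r // nnegrE ?hnorm_ge0 // ltW. Qed.

Lemma hnorm_le x r : 0 <= r -> (hnorm ip x <= r) = (rip x x <= r ^+ 2).
Proof. by move=> r0; rewrite -hnorm_sqr ler_pXn2r // nnegrE hnorm_ge0. Qed.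

Lemma hnormN x : hnorm ip (- x) = hnorm ip x.
Proof. by congr Num.sqrt; rewrite ipNl ipNr opprK. Qed.

Lemma hnormB x y : hnorm ip (x - y) = hnorm ip (y - x).
Proof. by rewrite -hnormN opprB. Qed.

Lemma normc_ge0 a : 0 <= Normc.normc a.
Proof. by case: a => b c; apply: sqrtr_ge0. Qed.

Lemma hnormZ a x : hnorm ip (a *: x) = Normc.normc a * hnorm ip x.
Proof.
rewrite /hnorm ipZl ipZr ipxx; case: a => b c /=.
rewrite -sqrtrM ?addr_ge0 ?sqr_ge0 //; congr Num.sqrt.
by ring.
Qed.

Lemma cauchy_schwarz x y : `|rip x y| <= hnorm ip x * hnorm ip y.
Proof.
have [y0|y0] := eqVneq (rip y y) 0.
  by rewrite (ripxx_eq0 y0) /rip ip0r normr0 mulr_ge0 ?hnorm_ge0.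
have yp : 0 < rip y y by rewrite lt_def y0 ripxx_ge0.
rewrite -(ler_pXn2r (n := 2)) ?nnegrE ?mulr_ge0 ?hnorm_ge0 //.
rewrite real_normK ?num_real // exprMn !hnorm_sqr.
(* This vector is [rip y y] times the component of [x] orthogonal to [y] for the real form. *)
have := ripxx_ge0 ((rip y y)%:C%C *: x - (rip x y)%:C%C *: y).
rewrite !ripE (ripC x y).
rewrite [X in 0 <= X](_ : _ = rip y y * (rip x x * rip y y - rip x y ^+ 2)).
  by rewrite pmulr_rge0 // subr_ge0.
by ring.
Qed.

Lemma hnormD x y : hnorm ip (x + y) <= hnorm ip x + hnorm ip y.
Proof.
rewrite hnorm_le ?addr_ge0 ?hnorm_ge0 // sqrrD !hnorm_sqr !ripE (ripC x y).
have := le_trans (ler_norm _) (cauchy_schwarz x y).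
rewrite -mulr_natl; lra.
Qed.

Lemma hnorm_triangle y x z : hnorm ip (x - z) <= hnorm ip (x - y) + hnorm ip (y - z).
Proof. by apply: le_trans (hnormD _ _); rewrite addrA subrK. Qed.

Lemma eq0_of_small r b : (forall e, 0 < e -> `|r| <= e * b) -> r = 0.
Proof.
move=> h; apply/eqP/negPn/negP => r0.
have rp : 0 < `|r| by rewrite normr_gt0.
have b0 : 0 < b by have := lt_le_trans rp (h 1 ltr01); rewrite mul1r.
(* This choice of [e] turns the hypothesis into [|r| <= |r| / 2]. *)
have := h (`|r| / 2 / b); rewrite divfK ?gt_eqF // !divr_gt0 // => /(_ isT).
by lra.
Qed.

Lemma rip0_limit x z :
  (forall e, 0 < e -> exists y, rip y z = 0 /\ hnorm ip (x - y) < e) -> rip x z = 0.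
Proof.
move=> h; apply: (@eq0_of_small _ (hnorm ip z)) => e /h [y [yz xy]].
rewrite (_ : rip x z = rip (x - y) z); last by rewrite !ripE yz subr0.
apply: le_trans (cauchy_schwarz _ _) _.
by rewrite ler_wpM2r ?hnorm_ge0 // ltW.
Qed.

(** The imaginary part of [ip x z] is, up to sign, the real form at ['i *: x]; complex orthogonality
    thus reduces to two real equations. *)
Lemma ip_eq0P x z : rip x z = 0 -> rip ('i%C *: x) z = 0 -> ip x z = 0.
Proof.
move=> h1 h2; apply/eqP; rewrite eq_complex /= -/(rip x z) rip_Im h1 h2.
by rewrite oppr0 !eqxx.
Qed.

Lemma ip0_limit x z :
  (forall e, 0 < e -> exists y, ip y z = 0 /\ hnorm ip (x - y) < e) -> ip x z = 0.
Proof.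
move=> h; apply: ip_eq0P; apply: rip0_limit => e /h [y [yz xy]].
  by exists y; rewrite /rip yz.
exists ('i%C *: y); rewrite /rip ipZl yz mulr0; split=> //.
rewrite -scalerBr hnormZ /= [X in Num.sqrt X](_ : _ = 1) ?sqrtr1 ?mul1r //; ring.
Qed.

Lemma rip_i x z : rip ('i%C *: x) z = - rip x ('i%C *: z).
Proof. by rewrite /rip ipZl ipZr; case: (ip x z) => b c /=; ring. Qed.

(** * Closed subspaces and orthogonal projections *)

Lemma subspaceN (M : H -> Prop) x : subspace M -> M x -> M (- x).
Proof. by case=> _ _ hZ hx; rewrite -scaleN1r; apply: hZ. Qed.

Lemma subspaceB (M : H -> Prop) x y : subspace M -> M x -> M y -> M (x - y).
Proof. by move=> hM hx hy; case: (hM) => _ hD _; apply: hD => //; apply: subspaceN. Qed.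

Lemma closed_subspaceI (M N : H -> Prop) : closed_subspace ip M ->
  closed_subspace ip N -> closed_subspace ip (fun x => M x /\ N x).
Proof.
move=> [[m0 mD mZ] mC] [[n0 nD nZ] nC]; split; first split=> //.
- by move=> x y [? ?] [? ?]; split; [apply: mD|apply: nD].
- by move=> a x [? ?]; split; [apply: mZ|apply: nZ].
- by move=> u l h c; split; [apply: mC c => n|apply: nC c => n]; case: (h n).
Qed.

Lemma hcvg_approx (u : nat -> H) l e : hcvg ip u l -> 0 < e ->
  exists n, hnorm ip (l - u n) < e.
Proof. by move=> c /c [N h]; exists N; rewrite hnormB h. Qed.

Lemma orth_compl_closed (S : H -> Prop) : closed_subspace ip (orth_compl ip S).
Proof.
split; first split.
- by move=> y _; rewrite ip0l.
- by move=> x y hx hy z hz; rewrite ipDl hx // hy // addr0.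
- by move=> a x hx z hz; rewrite ipZl hx // mulr0.
move=> u l hu hc z hz; apply: ip0_limit => e /(hcvg_approx hc) [n hn].
by exists (u n); split=> //; apply: hu.
Qed.

Lemma iter_lt (phi : nat -> nat) : (forall n, (phi n < phi n.+1)%N) ->
  forall n, (n <= phi n)%N.
Proof. by move=> h; elim=> // n ih; apply: leq_ltn_trans (h n). Qed.

Lemma hcvg_cauchy (u : nat -> H) l : hcvg ip u l -> hcauchy ip u.
Proof.
move=> c e e0; have e2 : 0 < e / 2 by rewrite divr_gt0.
have [N h] := c _ e2; exists N => m n hm hn.
apply: le_lt_trans (hnorm_triangle l _ _) _.
by rewrite (hnormB l) [e]splitr ltrD // h.
Qed.

Hypothesis hcomplete : forall u, hcauchy ip u -> exists l, hcvg ip u l.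

Lemma natSinv_small r : 0 < r -> exists N : nat, forall n, (N <= n)%N ->
  n.+1%:R^-1 < r.
Proof.
move=> r0; have [N hN] := ltr_add_invr r0; exists N => n hn.
apply: le_lt_trans (hN); rewrite add0r lef_pV2 ?posrE ?ltr0n //.
by rewrite ler_nat.
Qed.

(** A sequence in [M] minimizing the distance to [x] is Cauchy by the parallelogram law; its limit
    attains the infimum, and the first variation there gives orthogonality. *)
Theorem projection (M : H -> Prop) x : closed_subspace ip M ->
  exists y, M y /\ orth_compl ip M (x - y).
Proof.
move=> [hM hcl]; have [m0 mD mZ] := hM.
pose E : set R := [set r | exists y, M y /\ r = rip (x - y) (x - y)]%classic.
have hE : has_inf E.
  split; first by exists (rip (x - 0) (x - 0)), 0.
  by exists 0 => r [y [_ ->]]; apply: ripxx_ge0.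
pose d := inf E.
have dle y : M y -> d <= rip (x - y) (x - y).
  by move=> hy; apply: ge_inf; [exact: hE.2|exists y].
have /choice [u hu] n : exists y, M y /\ rip (x - y) (x - y) < d + n.+1%:R^-1.
  have h0 : 0 < n.+1%:R^-1 :> R by rewrite invr_gt0 ltr0n.
  by have [r [y [hy ->]] hr] := inf_adherent h0 hE; exists y.
have hC : hcauchy ip u.
  move=> e e0; have e4 : 0 < e ^+ 2 / 4 by rewrite divr_gt0 ?exprn_gt0.
  have [N hN] := natSinv_small e4.
  exists N => m n /hN hm /hN hn; rewrite hnorm_lt //.
  have [um hum] := hu m; have [un hun] := hu n.
  (* The midpoint of [u m] and [u n] lies in [M], so [d] bounds its squared distance to [x] from
     below; the parallelogram law then leaves at most 2/(m+1) + 2/(n+1). *)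
  have := dle _ (mZ (2^-1)%:C%C _ (mD _ _ um un)).
  have -> : x - (2^-1)%:C%C *: (u m + u n)
     = (2^-1)%:C%C *: ((x - u m) + (x - u n)).
    rewrite addrACA -opprD scalerBr -mulr2n -scaler_nat scalerA.
    rewrite (_ : _ * _ = 1) ?scale1r //.
    by rewrite fmorphV rmorph_nat mulVf ?pnatr_eq0.
  have -> : u m - u n = (x - u n) - (x - u m).
    by rewrite opprB [RHS]addrC addrA subrK.
  move: (x - u m) (x - u n) hum hun => a b ha hb.
  rewrite !ripE (ripC a b).
  by move: (m.+1%:R^-1) (n.+1%:R^-1) (e ^+ 2) hm hn ha hb => p q s; lra.
have [y hy] := hcomplete hC; exists y.
have My : M y by apply: hcl hy => n; case: (hu n).
split=> //.
have dy : rip (x - y) (x - y) <= d.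
  rewrite leNgt; apply/negP => hlt.
  set s := hnorm ip (x - y).
  have s0 : 0 <= s by apply: hnorm_ge0.
  have hs : s ^+ 2 = rip (x - y) (x - y) by apply: hnorm_sqr.
  (* With t = |x - u n| and q = |u n - y| < g/(4(s+1)), the triangle inequality gives s^2 - t^2 <=
     2sq < g/2, whereas t^2 < d + 1/(n+1) < s^2 - g/2 for large n. *)
  pose g := s ^+ 2 - d; have g0 : 0 < g by rewrite subr_gt0 hs.
  have k0 : 0 < g / (4 * (s + 1)) by rewrite divr_gt0 // mulr_gt0 //; lra.
  have [N1 h1] := hy _ k0; have g2 : 0 < g / 2 by lra.
  have [N2 h2] := natSinv_small g2.
  have := h1 _ (leq_maxl N1 N2); have := h2 _ (leq_maxr N1 N2).
  set n := maxn N1 N2 => hn hun.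
  have [_] := hu n; rewrite -hnorm_sqr.
  have := hnorm_triangle (u n) x y; rewrite -/s.
  have := hnorm_ge0 (x - u n); set t := hnorm ip (x - u n).
  set q := hnorm ip _ in hun * => t0 tri ht.
  have hq : q * (4 * (s + 1)) < g by rewrite -ltr_pdivlMr //; lra.
  have q0 : 0 <= q by apply: hnorm_ge0.
  have ht2 : t ^+ 2 < s ^+ 2 - g / 2.
    by apply: lt_trans ht _; move: (n.+1%:R^-1) hn; rewrite /g => k; lra.
  have st : t < s by rewrite -(ltr_pXn2r (n := 2)) ?nnegrE //; lra.
  have : (s - t) * (s + t) <= q * (s + t) by rewrite ler_wpM2r ?addr_ge0 //; lra.
  have : q * (s + t) <= q * (s + s) by rewrite ler_wpM2l // lerD2l ltW.
  by lra.
suff hr z : M z -> rip (x - y) z = 0.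
  move=> z hz; apply: ip_eq0P; first exact: hr.
  by rewrite rip_i hr ?oppr0 //; apply: mZ.
move=> hz; apply: (@eq0_of_small _ (rip z z)) => e e0.
(* Compare [y] with the competitor [y + t z]; the values t = e and t = -e together bound |<x - y,
   z>|. *)
have h t : M z -> 0 <= - (2 * t * rip (x - y) z) + t ^+ 2 * rip z z.
  move=> _; have := dle _ (mD _ _ My (mZ t%:C%C _ hz)).
  rewrite opprD addrA; move: (x - y) dy => w dy.
  by rewrite !ripE (ripC w z); nra.
have := h e hz; have := h (- e) hz => h1 h2.
have zz := ripxx_ge0 z.
have : e * `|rip (x - y) z| <= e * (e * rip z z).
  by case: (ler0P (rip (x - y) z)) => _; nra.
by rewrite ler_pM2l.
Qed.

(** * Linear spans and closed spans *)

Lemma hspan_mem (S : H -> Prop) x : S x -> hspan S x.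
Proof.
move=> hx; exists 1%N, (fun=> 1), (fun=> x); split=> //.
by rewrite big_ord1 scale1r.
Qed.

Lemma hspan_subspace (S : H -> Prop) : subspace (hspan S).
Proof.
split.
- by exists 0%N, (fun=> 0), (fun=> 0); rewrite big_ord0.
- move=> _ _ [n [c [v [hv ->]]]] [m [d [w [hw ->]]]].
  exists (n + m)%N, (fun i => if (i < n)%N then c i else d (i - n)%N),
    (fun i => if (i < n)%N then v i else w (i - n)%N); split=> [i hi|].
    by case: ltnP => hn; [apply: hv|apply: hw; rewrite ltn_subLR].
  rewrite big_split_ord /=; congr (_ + _); apply: eq_bigr => i _ /=.
    by rewrite ltn_ord.
  by rewrite ltnNge leq_addr /= addKn.
- move=> a _ [n [c [v [hv ->]]]]; exists n, (fun i => a * c i), v; split=> //.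
  by rewrite scaler_sumr; apply: eq_bigr => i _; rewrite scalerA.
Qed.

Lemma hspan_min (S M : H -> Prop) : subspace M -> (forall x, S x -> M x) ->
  forall x, hspan S x -> M x.
Proof.
move=> [m0 mD mZ] SM _ [n [c [v [hv ->]]]].
elim/big_ind: _ => // i _; apply/mZ/SM/hv; exact: ltn_ord.
Qed.

Lemma cspan_mem (S : H -> Prop) x : S x -> cspan ip S x.
Proof.
by move=> hx e e0; exists x; rewrite subrr hnorm0; split=> //; apply: hspan_mem.
Qed.

Lemma cspan_min (S M : H -> Prop) : closed_subspace ip M ->
  (forall x, S x -> M x) -> forall x, cspan ip S x -> M x.
Proof.
move=> [hM hcl] SM x hx.
have /choice [u hu] n : exists y, hspan S y /\ hnorm ip (x - y) < n.+1%:R^-1.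
  by apply: hx; rewrite invr_gt0 ltr0n.
apply: (hcl u) => [n|e e0]; first by apply: hspan_min (hu n).1.
have [N hN] := natSinv_small e0; exists N => n /hN.
by apply: lt_trans; rewrite hnormB (hu n).2.
Qed.

Lemma cspan_closed (S : H -> Prop) : closed_subspace ip (cspan ip S).
Proof.
have [s0 sD sZ] := hspan_subspace S.
have e2 (e : R) : 0 < e -> 0 < e / 2 by move=> e0; rewrite divr_gt0.
split; first split.
- by move=> e e0; exists 0; rewrite subrr hnorm0.
- move=> x y hx hy e e0.
  have [x' [sx hx']] := hx _ (e2 _ e0); have [y' [sy hy']] := hy _ (e2 _ e0).
  exists (x' + y'); split; first exact: sD.
  rewrite opprD addrACA; apply: le_lt_trans (hnormD _ _) _.
  by rewrite [e]splitr ltrD.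
- move=> a x hx e e0; have a0 := normc_ge0 a.
  have k0 : 0 < e / (Normc.normc a + 1) by rewrite divr_gt0 // ltr_wpDl.
  have [y [sy hy]] := hx _ k0; exists (a *: y); split; first exact: sZ.
  rewrite -scalerBr hnormZ.
  have : hnorm ip (x - y) * (Normc.normc a + 1) < e.
    by rewrite -ltr_pdivlMr // ltr_wpDl.
  by apply: le_lt_trans; rewrite mulrC ler_wpM2l ?hnorm_ge0 // lerDl.
- move=> u l hu hc e e0.
  have [n hn] := hcvg_approx hc (e2 _ e0).
  have [y [sy hy]] := hu n _ (e2 _ e0); exists y; split=> //.
  by apply: le_lt_trans (hnorm_triangle (u n) _ _) _; rewrite [e]splitr ltrD.
Qed.

Lemma cspan_orth (S : H -> Prop) x z :
  (forall s, S s -> ip s z = 0) -> cspan ip S x -> ip x z = 0.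
Proof.
move=> hz; have hS s : S s -> orth_compl ip (eq z) s by move=> /hz h _ <-.
by move=> /(cspan_min (orth_compl_closed (eq z)) hS); apply.
Qed.

(** The closed span is the double orthocomplement: the residue of [x] after projection is orthogonal
    to [S], hence to [x] and to itself. *)
Lemma cspanP (S : H -> Prop) x :
  cspan ip S x <-> (forall z, (forall s, S s -> ip s z = 0) -> ip x z = 0).
Proof.
split=> [hx z hz|hx]; first exact: cspan_orth hz hx.
have [p [hp hxp]] := projection x (cspan_closed S).
have h0 : ip x (x - p) = 0.
  by apply: hx => s hs; apply/ip_eq0C/hxp/cspan_mem.
suff /eqP : x - p = 0 by rewrite subr_eq0 => /eqP ->.
by apply: ipxx_eq0; rewrite ipBl h0 (ip_eq0C (hxp _ hp)) subrr.
Qed.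

(** * Spectral theorem for compact normal operators *)

Definition seq_compact (T : H -> H) : Prop :=
  forall u : nat -> H, (exists M : R, forall n, hnorm ip (u n) <= M) ->
    exists (phi : nat -> nat) (l : H),
      (forall n, (phi n < phi n.+1)%N) /\ hcvg ip (fun n => T (u (phi n))) l.

Lemma hlinearD (T : H -> H) x y : hlinear T -> T (x + y) = T x + T y.
Proof. by move=> h; rewrite -[x in LHS]scale1r h scale1r. Qed.

Lemma hlinear0 (T : H -> H) : hlinear T -> T 0 = 0.
Proof. by move=> h; apply: (addrI (T 0)); rewrite -hlinearD // !addr0. Qed.

Lemma hlinearZ (T : H -> H) a x : hlinear T -> T (a *: x) = a *: T x.
Proof. by move=> h; rewrite -[_ *: x]addr0 h hlinear0 // addr0. Qed.

Lemma hlinearB (T : H -> H) x y : hlinear T -> T (x - y) = T x - T y.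
Proof. by move=> h; rewrite -scaleN1r hlinearD // hlinearZ // scaleN1r. Qed.

(* With M = sup ||Ax||^2 over unit vectors, a maximizing sequence satisfies
   A^2 x_n - M x_n -> 0; compactness of A yields y <> 0 with A^2 y = M y, and
   (A - sqrt M) (A + sqrt M) y = 0. *)
Theorem compact_selfadjoint_eigenvector (A : H -> H) (K : H -> Prop) :
  bounded_op ip A -> seq_compact A -> (forall x y, ip (A x) y = ip x (A y)) ->
  closed_subspace ip K -> Defs.invariant A K -> (exists x, K x /\ x <> 0) ->
  exists (r : R) v, [/\ K v, v <> 0 & A v = r%:C%C *: v].
Proof.
move=> [hlin [B hB]] hcpt hsa [[k0 kD kZ] kcl] hAK [x0 [Kx0 x0n]].
have sa x y : rip (A x) y = rip x (A y) by rewrite /rip hsa.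
have linD x y : A (x + y) = A x + A y := hlinearD x y hlin.
have A0 := hlinear0 hlin.
have linZ a x : A (a *: x) = a *: A x := hlinearZ a x hlin.
pose E : set R := [set s | exists x, [/\ K x, rip x x = 1 & s = rip (A x) (A x)]]%classic.
have unit x : K x -> x <> 0 -> exists2 c : R, c != 0 &
    rip (c%:C%C *: x) (c%:C%C *: x) = 1.
  move=> Kx xn; have h : hnorm ip x != 0 by apply/eqP => /hnorm_eq0.
  exists (hnorm ip x)^-1; first by rewrite invr_eq0.
  by rewrite !ripE -hnorm_sqr mulrA -expr2 -exprMn mulVf ?expr1n.
have hE : has_sup E.
  split.
    have [c _ hc] := unit _ Kx0 x0n.
    exists (rip (A (c%:C%C *: x0)) (A (c%:C%C *: x0))), (c%:C%C *: x0).
    by split=> //; apply: kZ.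
  exists (B ^+ 2) => s [x [Kx hx ->]]; have := hB x.
  have -> : hnorm ip x = 1 by rewrite /hnorm -/(rip x x) hx sqrtr1.
  rewrite mulr1 => h; rewrite -hnorm_sqr ler_pXn2r ?nnegrE ?hnorm_ge0 //.
  exact: le_trans (hnorm_ge0 _) h.
pose M := sup E.
have hM x : K x -> rip (A x) (A x) <= M * rip x x.
  move=> Kx; have [->|/eqP xn] := eqVneq x 0; first by rewrite A0 /rip !ip0l mulr0.
  have [c c0 hc] := unit _ Kx xn.
  have h : rip (A (c%:C%C *: x)) (A (c%:C%C *: x)) <= M.
    by apply: sup_upper_bound => //; exists (c%:C%C *: x); split=> //; apply: kZ.
  rewrite -[X in _ <= X]mulr1 -hc linZ !ripE in h.
  have c2 : 0 < c ^+ 2 by rewrite exprn_even_gt0.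
  rewrite -(ler_pM2l c2) expr2 -!mulrA (le_trans h) // le_eqVlt.
  by apply/orP; left; apply/eqP; ring.
have M0 : 0 <= M.
  have [s [x [Kx hx hs]]] := hE.1; apply: le_trans (ripxx_ge0 (A x)) _.
  by rewrite -[M]mulr1 -hx hM.
have [MZ|Mn] := eqVneq M 0.
  exists 0, x0; split=> //; rewrite scale0r; apply: ripxx_eq0; apply/eqP.
  by rewrite eq_le ripxx_ge0 andbT; have := hM _ Kx0; rewrite MZ mul0r.
have Mp : 0 < M by rewrite lt_def Mn.
have /choice [u hu] n : exists x, [/\ K x, rip x x = 1 & M - n.+1%:R^-1 < rip (A x) (A x)].
  have h0 : 0 < n.+1%:R^-1 :> R by rewrite invr_gt0 ltr0n.
  by have [s [x [Kx hx ->]] hs] := sup_adherent h0 hE; exists x.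
have [|phi [y [hphi hy]]] := hcpt u.
  by exists 1 => n; have [_ h _] := hu n; rewrite /hnorm -/(rip _ _) h sqrtr1.
have Ky : K y by apply: kcl hy => n; apply: hAK; case: (hu (phi n)).
have near (e : R) : 0 < e -> exists n, hnorm ip (y - A (u (phi n))) < e /\
    M - rip (A (u (phi n))) (A (u (phi n))) < e.
  move=> e0; have [N1 h1] := hy _ e0; have [N2 h2] := natSinv_small e0.
  exists (maxn N1 N2); rewrite hnormB h1 ?leq_maxl //; split=> //.
  have [_ _] := hu (phi (maxn N1 N2)).
  have := h2 (phi (maxn N1 N2)) (leq_trans (leq_maxr _ _) (iter_lt hphi _)).
  by move: (_.+1%:R^-1) => q; lra.
have A2 : A (A y) = M%:C%C *: y.
  apply/eqP; rewrite -subr_eq0; apply/eqP/ripxx_eq0.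
  have [w wE] : exists w, w = A (A y) - M%:C%C *: y by exists (A (A y) - M%:C%C *: y).
  rewrite -wE.
  (* Selfadjointness gives <w,w> = <y,z>, which leaves [y] alone on the left, ready to be replaced
     by [A v]. *)
  have [z zE] : exists z, z = A (A w) - M%:C%C *: w by exists (A (A w) - M%:C%C *: w).
  have -> : rip w w = rip y z by rewrite {1}wE zE !ripE !sa.
  apply: (@eq0_of_small _ (hnorm ip z + hnorm ip (A w))) => e e0.
  (* The bound [e] serves |y - A v|; the bound [e ^+ 2 / M] serves |A^2 v - M v|^2 <= M (M - |A
     v|^2), where |A^2 v|^2 <= M |A v|^2 is used. *)
  pose e' := Num.min e (e ^+ 2 / M).
  have e'0 : 0 < e' by rewrite lt_min e0 divr_gt0 ?exprn_gt0.
  have [n [h1 h2]] := near e' e'0.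
  have [Ku u1 _] := hu (phi n).
  move: (u (phi n)) Ku u1 h1 h2 => v Kv v1 h1 h2.
  have -> : rip y z = rip (y - A v) z + rip (A (A v) - M%:C%C *: v) (A w).
    by rewrite zE !ripE !sa; ring.
  apply: le_trans (ler_normD _ _) _; rewrite mulrDr lerD //.
    apply: le_trans (cauchy_schwarz _ _) _; rewrite ler_wpM2r ?hnorm_ge0 //.
    by apply/ltW/(lt_le_trans h1); rewrite ge_min lexx.
  apply: le_trans (cauchy_schwarz _ _) _; rewrite ler_wpM2r ?hnorm_ge0 //.
  rewrite hnorm_le ?(ltW e0) // !ripE (sa (A v) v) -(sa v (A v)) v1.
  have h3 := hM _ (hAK _ Kv).
  have : M * (M - rip (A v) (A v)) < e ^+ 2.
    rewrite mulrC -ltr_pdivlMr //; apply: (lt_le_trans h2).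
    by rewrite ge_min lexx orbT.
  by move: h3; lra.
have yn : y <> 0.
  (* If [y = 0], then t = A v has |t| < 1 and |t| < M/2, so |t|^2 < M/2, against M - |t|^2 < M/2. *)
  move=> y0; have e0 : 0 < Num.min 1 (M / 2) by rewrite lt_min ltr01 divr_gt0.
  have [n []] := near _ e0; rewrite y0 sub0r hnormN; set t := A _.
  rewrite !lt_min -hnorm_sqr => /andP[h1 h2] /andP[_ h3].
  have : hnorm ip t * hnorm ip t <= hnorm ip t * 1.
    by rewrite ler_wpM2l ?hnorm_ge0 // ltW.
  by rewrite -expr2; lra.
pose m := Num.sqrt M.
have mm : m * m = M by rewrite -expr2 sqr_sqrtr.
(* Either (A + m) y = 0 and [y] has eigenvalue -m, or (A + m) y is an eigenvector for m. *)
have [z0|/eqP zn] := eqVneq (A y + m%:C%C *: y) 0.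
  exists (- m), y; split=> //; rewrite rmorphN scaleNr.
  by apply/eqP; rewrite -addr_eq0 z0.
exists m, (A y + m%:C%C *: y); split=> //.
  by apply: kD; [apply: hAK|apply: kZ].
by rewrite linD linZ A2 scalerDr scalerA -rmorphM mm addrC.
Qed.

(** * Adjoints, kernels and limits *)

Lemma adjointC (T Ts : H -> H) : is_adjoint ip T Ts -> is_adjoint ip Ts T.
Proof. by move=> h x y; rewrite ipC -h -ipC. Qed.

Lemma adjoint_hlinear (T Ts : H -> H) : is_adjoint ip T Ts -> hlinear T.
Proof.
move=> h a x y; apply: ip_inj => z.
by rewrite h !(ipDl, ipZl) !h.
Qed.

Lemma adjoint_unique (T Ts Ts' : H -> H) x :
  is_adjoint ip T Ts -> is_adjoint ip T Ts' -> Ts x = Ts' x.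
Proof. by move=> h h'; apply: ip_inj => z; rewrite (adjointC h) (adjointC h'). Qed.

Lemma adjoint_ker (T Ts : H -> H) x : is_adjoint ip T Ts ->
  (forall z, ip x (T z) = 0) -> Ts x = 0.
Proof. by move=> h hx; apply: ip_inj => z; rewrite (adjointC h) hx ip0l. Qed.

(** The kernel of [T] is the orthocomplement of the range of [Ts]; closedness comes from there
    rather than from continuity. *)
Lemma ker_closed (T Ts : H -> H) : is_adjoint ip T Ts ->
  closed_subspace ip (fun x => T x = 0).
Proof.
move=> h; rewrite (_ : (fun x => _) = orth_compl ip (fun y => exists z, y = Ts z)).
  exact: orth_compl_closed.
apply/funext => x; apply/propext; split=> [hx _ [z ->]|hx].
  by rewrite -h hx ip0l.
by apply: (adjoint_ker (adjointC h)) => z; apply: hx; exists z.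
Qed.

Lemma hcvgD (u v : nat -> H) l l' : hcvg ip u l -> hcvg ip v l' ->
  hcvg ip (fun n => u n + v n) (l + l').
Proof.
move=> hu hv e e0; have e2 : 0 < e / 2 by rewrite divr_gt0.
have [N h] := hu _ e2; have [N' h'] := hv _ e2.
exists (maxn N N') => n; rewrite geq_max => /andP[/h h1 /h' h2].
by rewrite opprD addrACA [e]splitr (le_lt_trans (hnormD _ _)) // ltrD.
Qed.

Lemma hcvgZ a (u : nat -> H) l : hcvg ip u l -> hcvg ip (fun n => a *: u n) (a *: l).
Proof.
move=> hu e e0; have a1 : 0 < Normc.normc a + 1 by rewrite ltr_wpDl ?normc_ge0.
have [N h] := hu _ (divr_gt0 e0 a1); exists N => n /h.
rewrite ltr_pdivlMr // => h1; rewrite -scalerBr hnormZ.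
by apply: le_lt_trans h1; rewrite mulrC ler_wpM2l ?hnorm_ge0 // lerDl.
Qed.

Section CompactNormal.
Variables X Xs : H -> H.
Hypotheses (bX : bounded_op ip X) (cX : seq_compact X).
Hypotheses (aX : is_adjoint ip X Xs) (nX : forall x, X (Xs x) = Xs (X x)).

Let lX : hlinear X := adjoint_hlinear aX.
Let lXs : hlinear Xs := adjoint_hlinear (adjointC aX).

Lemma normal_hnorm x : hnorm ip (Xs x) = hnorm ip (X x).
Proof. by congr (Num.sqrt (complex.Re _)); rewrite (adjointC aX) nX aX. Qed.

Lemma normal_ker x : X x = 0 <-> Xs x = 0.
Proof.
by split=> h; apply: hnorm_eq0; rewrite (normal_hnorm, =^~ normal_hnorm) h hnorm0.
Qed.

Lemma normal_comb_bounded a b : bounded_op ip (fun x => a *: X x + b *: Xs x).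
Proof.
split=> [c x y|].
  by rewrite lX lXs !scalerDr !scalerA !(mulrC c) addrACA.
have [_ [B hB]] := bX; exists (Normc.normc a * B + Normc.normc b * B) => x.
apply: le_trans (hnormD _ _) _.
by rewrite !hnormZ normal_hnorm mulrDl -!mulrA lerD // ler_wpM2l ?normc_ge0.
Qed.

(** By normality |X* x| = |X x|, so a subsequence on which [X] is Cauchy is one on which [Xs] is
    Cauchy. *)
Lemma normal_comb_compact a b : seq_compact (fun x => a *: X x + b *: Xs x).
Proof.
move=> u /cX [phi [l [hphi hl]]].
have [|l' hl'] := @hcomplete (fun n => Xs (u (phi n))).
  move=> e /(hcvg_cauchy hl) [N hN]; exists N => m n hm hn.
  by rewrite -hlinearB // normal_hnorm hlinearB // hN.
by exists phi, (a *: l + b *: l'); split=> //; apply: hcvgD; apply: hcvgZ.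
Qed.

Lemma compact_normal_eigenvector (K : H -> Prop) : closed_subspace ip K ->
  Defs.invariant X K -> Defs.invariant Xs K -> (exists x, K x /\ x <> 0) ->
  exists lam v, [/\ K v, v <> 0, X v = lam *: v & Xs v = conjc lam *: v].
Proof.
move=> hK iX iXs nz; have [_ kD kZ] := hK.1.
pose comb a b x := a *: X x + b *: Xs x.
have icomb a b M : subspace M -> Defs.invariant X M -> Defs.invariant Xs M ->
    Defs.invariant (comb a b) M.
  by move=> [_ D Z] hx hxs x Mx; apply: D; apply: Z; [apply: hx|apply: hxs].
have sa x y : ip (comb 1 1 x) y = ip x (comb 1 1 y).
  by rewrite /comb !scale1r ipDl ipDr aX (adjointC aX) addrC.
have sb x y : ip (comb 'i%C (- 'i%C) x) y = ip x (comb 'i%C (- 'i%C) y).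
  rewrite /comb !(ipDl, ipDr, ipZl, ipZr) aX (adjointC aX) addrC.
  congr (_ * _ + _ * _); apply/eqP; rewrite eq_complex /= ?opprK ?oppr0 ?eqxx //.
have [r [w [Kw wn Aw]]] := compact_selfadjoint_eigenvector
  (normal_comb_bounded 1 1) (@normal_comb_compact 1 1) sa hK (icomb 1 1 K hK.1 iX iXs) nz.
pose T x := X x + Xs x - r%:C%C *: x.
have hT : is_adjoint ip T T.
  move=> x y; rewrite /T ipBl ipBr ipDl ipDr ipZl ipZr aX (adjointC aX).
  by rewrite conjc_real (addrC (ip x (Xs y))).
have lT := adjoint_hlinear hT.
have TX x : T (X x) = X (T x).
  by rewrite /T (hlinearB _ _ lX) (hlinearD _ _ lX) (hlinearZ _ _ lX) nX.
have TXs x : T (Xs x) = Xs (T x).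
  by rewrite /T (hlinearB _ _ lXs) (hlinearD _ _ lXs) (hlinearZ _ _ lXs) nX.
have hK' := closed_subspaceI hK (ker_closed hT).
have iX' : Defs.invariant X (fun x => K x /\ T x = 0).
  by move=> x [kx tx]; split; [apply: iX|rewrite TX tx hlinear0].
have iXs' : Defs.invariant Xs (fun x => K x /\ T x = 0).
  by move=> x [kx tx]; split; [apply: iXs|rewrite TXs tx hlinear0].
have [|s [v [[Kv Tv] vn Bv]]] := compact_selfadjoint_eigenvector
  (normal_comb_bounded 'i%C (- 'i%C)) (@normal_comb_compact 'i%C (- 'i%C)) sb hK'
  (icomb 'i%C (- 'i%C) _ hK'.1 iX' iXs').
  by exists w; split=> //; split=> //; rewrite /T -Aw !scale1r subrr.
have e1 : X v + Xs v = r%:C%C *: v by apply/eqP; rewrite -subr_eq0; apply/eqP.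
have e2 : X v - Xs v = (- 'i%C * s%:C%C) *: v.
  by rewrite -scalerA -Bv scalerDr !scalerA mulrNN mulNr -expr2 sqr_i opprK scale1r scaleN1r.
have i2 : (2^-1 : R[i]) + 2^-1 = 1 by rewrite [RHS]splitr mul1r.
exists (2^-1 * (r%:C%C - 'i%C * s%:C%C)), v; split=> //.
  rewrite -scalerA scalerDl -mulNr -e1 -e2 addrACA subrr addr0.
  by rewrite scalerDr -scalerDl i2 scale1r.
rewrite (_ : conjc _ = 2^-1 * (r%:C%C - (- 'i%C * s%:C%C))); last first.
  rewrite rmorphM fmorphV rmorph_nat; congr (_ * _).
  by apply/eqP; rewrite eq_complex /=; apply/andP; split; apply/eqP; ring.
rewrite -scalerA scalerBl -e1 -e2 opprB (addrC (X v)) addrACA subrr addr0.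
by rewrite scalerDr -scalerDl i2 scale1r.
Qed.

(** * Orthonormal eigenbases indexed by natural numbers *)

Hypothesis hseparable :
  exists d : nat -> H, forall x (e : R), 0 < e -> exists n, hnorm ip (x - d n) < e.

Lemma orthonormal_dist x y : ip x x = 1 -> ip y y = 1 -> ip x y = 0 ->
  rip (x - y) (x - y) = 2.
Proof.
by move=> hx hy hxy; rewrite !ripE (ripC x y) /rip hx hy hxy /=; ring.
Qed.

(* The index of a basis vector is that of a term of a dense sequence within
   distance 1/2 of it: distinct orthonormal vectors are sqrt 2 apart. *)
Lemma orthonormal_indexing (S : H -> Prop) :
  (forall x y, S x -> S y -> ip x y = (x == y)%:R) ->
  exists (J : nat -> Prop) (f : nat -> H),
    [/\ forall j, J j -> S (f j), forall x, S x -> exists j, J j /\ x = f j &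
        forall i j, J i -> J j -> ip (f i) (f j) = (i == j)%:R].
Proof.
move=> hS; have [d hd] := hseparable.
have half0 : 0 < 2^-1 :> R by rewrite invr_gt0.
have /choice [g hg] x : exists n, hnorm ip (x - d n) < 2^-1 by apply: hd.
have ginj x y : S x -> S y -> g x = g y -> x = y.
  move=> Sx Sy gxy; apply/eqP/negPn/negP => xy.
  have h : hnorm ip (x - y) < 1.
    apply: le_lt_trans (hnorm_triangle (d (g x)) _ _) _.
    by rewrite [X in _ < X]splitr mul1r ltrD ?hg // hnormB gxy hg.
  move: h; rewrite hnorm_lt // orthonormal_dist ?hS ?eqxx ?(negbTE xy) //.
  by rewrite expr1n; lra.
have /choice [f hf] n : exists x, (exists y, S y /\ g y = n) -> S x /\ g x = n.
  (* The witness 0 serves the indices that no element of [S] hits, which the index set leaves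
     out. *)
  by have [[y hy]|no] := pselect (exists y, S y /\ g y = n); [exists y|exists 0].
exists (fun n => exists y, S y /\ g y = n), f; split.
- by move=> j /hf [].
- move=> x Sx; have hx : exists y, S y /\ g y = g x by exists x.
  by exists (g x); split=> //; have [Sf gf] := hf _ hx; apply: ginj.
- move=> i j /hf [Si gi] /hf [Sj gj]; rewrite hS //; congr (nat_of_bool _)%:R.
  by apply/eqP/eqP => [fij|->] //; rewrite -gi -gj fij.
Qed.

(** Zorn's lemma yields a maximal orthonormal set [S] of joint eigenvectors in [E]. The
    orthocomplement of [S] in [E] is invariant under [X] and [Xs], so if nonzero it would contain
    one more eigenvector. *)
Theorem compact_normal_eigenbasis (E : H -> Prop) : closed_subspace ip E ->
  Defs.invariant X E -> Defs.invariant Xs E ->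
  exists (J : nat -> Prop) (f : nat -> H), orthonormal_basis ip J f E /\
    forall j, J j -> exists lam, X (f j) = lam *: f j /\ Xs (f j) = conjc lam *: f j.
Proof.
move=> hE iX iXs.
pose eig x := exists lam, X x = lam *: x /\ Xs x = conjc lam *: x.
pose P : set (set H) := [set S | (forall x, S x -> E x /\ eig x) /\
  forall x y, S x -> S y -> ip x y = (x == y)%:R]%classic.
have [|S [[SE Son] Smax]] := @Zorn_bigcup H P.
  move=> F FP Ftot; split=> [x [A /FP [hA _] Ax]|x y [A FA Ax] [B FB By]].
    exact: hA.
  by have [AB|BA] := Ftot A B FA FB; [have [_] := FP _ FB; apply=> //; apply: AB
    |have [_] := FP _ FA; apply=> //; apply: BA].
have K0 v : E v -> orth_compl ip S v -> v = 0.
  move=> Ev Sv; apply/eqP/negPn/negP => /eqP vn.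
  have hK := closed_subspaceI hE (orth_compl_closed S).
  have [|||lam [w [[Ew Sw] wn Xw Xsw]]] := compact_normal_eigenvector hK _ _ _.
  - move=> x [Ex Sx]; split; [exact: iX|move=> y Sy].
    by have [_ [l [_ hl]]] := SE _ Sy; rewrite aX hl ipZr Sx // mulr0.
  - move=> x [Ex Sx]; split; [exact: iXs|move=> y Sy].
    by have [_ [l [hl _]]] := SE _ Sy; rewrite (adjointC aX) hl ipZr Sx // mulr0.
  - by exists v.
  pose c := (hnorm ip w)^-1; have hw : hnorm ip w != 0 by apply/eqP => /hnorm_eq0.
  have c1 : ip (c%:C%C *: w) (c%:C%C *: w) = 1.
    rewrite ipxx !ripE -hnorm_sqr mulrA -expr2 -exprMn mulVf //.
    by rewrite expr1n.
  have cS y : S y -> ip (c%:C%C *: w) y = 0 by move=> Sy; rewrite ipZl Sw // mulr0.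
  have nS : ~ S (c%:C%C *: w).
    by move=> /cS; rewrite c1 => /eqP; rewrite oner_eq0.
  apply: (Smax (fun x => S x \/ x = c%:C%C *: w)).
    by split=> [x Sx|h]; [left|apply: nS; apply: h; right].
  split=> [x [/SE //|->]|x y].
    split; first by have [_ _ hZ] := hE.1; apply: hZ.
    exists lam; rewrite (hlinearZ _ _ lX) (hlinearZ _ _ lXs) Xw Xsw.
    by rewrite !scalerA ![c%:C%C * _]mulrC.
  move=> [Sx|->] [Sy|->]; first exact: Son.
  - by have [xw|_] := eqVneq x (c%:C%C *: w); [by case: nS; rewrite -xw|exact: ip_eq0C (cS _ Sx)].
  - by have [wy|_] := eqVneq (c%:C%C *: w) y; [by case: nS; rewrite wy|exact: cS].
  - by rewrite c1 eqxx.
have [J [f [JS Sf fon]]] := orthonormal_indexing Son.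
exists J, f; split; last by move=> j /JS /SE [].
split=> // [i /JS /SE []//|x].
pose B y := exists i, J i /\ y = f i.
have BE y : B y -> E y by move=> [i [/JS /SE [? _] ->]].
split=> [Ex|]; last exact: cspan_min.
have [p [hp hxp]] := projection x (cspan_closed B).
suff /eqP : x - p = 0 by rewrite subr_eq0 => /eqP ->.
apply: K0; first by apply: (subspaceB hE.1 Ex); apply: cspan_min hp.
by move=> y /Sf [j [Jj ->]]; apply/hxp/cspan_mem; exists j.
Qed.

End CompactNormal.

(** * Doubly commuting isometries *)

(** Polarization for the real form, then linearity at ['i *: x] for the imaginary part. *)
Lemma isometry_ip (V : H -> H) x y : Defs.isometry ip V -> ip (V x) (V y) = ip x y.
Proof.
move=> [lV nV].
have sq z : rip (V z) (V z) = rip z z by rewrite -!hnorm_sqr nV.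
have rV z w : rip (V z) (V w) = rip z w.
  by have := sq (z + w); rewrite hlinearD // !ripE !sq (ripC (V z)) (ripC z); lra.
apply/eqP; rewrite eq_complex !rip_Im -(hlinearZ _ _ lV) -!/(rip _ _) !rV.
by rewrite !eqxx.
Qed.

Lemma isometry_adjointK (V Vs : H -> H) x :
  Defs.isometry ip V -> is_adjoint ip V Vs -> Vs (V x) = x.
Proof. by move=> iV aV; apply: ip_inj => y; rewrite (adjointC aV) isometry_ip. Qed.

Lemma adjoint_comm (A B As Bs : H -> H) x :
  is_adjoint ip A As -> is_adjoint ip B Bs -> (forall x, A (B x) = B (A x)) ->
  As (Bs x) = Bs (As x).
Proof.
by move=> aA aB hAB; apply: ip_inj => y; rewrite !(adjointC aA, adjointC aB) hAB.
Qed.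

Lemma iter_adjoint (A As : H -> H) m :
  is_adjoint ip A As -> is_adjoint ip (iter m A) (iter m As).
Proof. by move=> aA; elim: m => [//|m ih] x y; rewrite iterS aA ih -iterSr. Qed.

Lemma iter_invariant (f : H -> H) (M : H -> Prop) m :
  Defs.invariant f M -> Defs.invariant (iter m f) M.
Proof. by move=> fM; elim: m => [//|m ih] x /ih; apply: fM. Qed.

Lemma iter_comm (f g : H -> H) (M : H -> Prop) m x : Defs.invariant f M ->
  (forall y, M y -> f (g y) = g (f y)) -> M x -> iter m f (g x) = g (iter m f x).
Proof.
move=> fM hfg Mx; elim: m => [//|m ih].
by rewrite !iterS ih hfg //; apply: iter_invariant.
Qed.

Definition doubly_commuting_on (A B As Bs : H -> H) (M : H -> Prop) : Prop :=
  [/\ [/\ is_adjoint ip A As, is_adjoint ip B Bs, cancel A As & cancel B Bs],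
      closed_subspace ip M, reducing A B As Bs M, (forall x, A (B x) = B (A x)) &
      forall x, M x -> Bs (A x) = A (Bs x) /\ As (B x) = B (As x)].

Lemma doubly_commuting_sym (A B As Bs : H -> H) (M : H -> Prop) :
  doubly_commuting_on A B As Bs M -> doubly_commuting_on B A Bs As M.
Proof.
move=> [[aA aB kA kB] hM [iA iB iAs iBs] hc hdc]; split=> //.
by move=> x /hdc [].
Qed.

(** The unitary summand of the Wold decomposition: for an isometry [A], A^m A*^m is the projection
    onto the range of A^m, so these vectors lie in all the ranges. *)
Definition unitary_part (A As : H -> H) (M : H -> Prop) : H -> Prop :=
  fun x => M x /\ forall m, iter m A (iter m As x) = x.

(** * The unitary part of one isometry of a doubly commuting pair *)

Section UnitaryPart.
Variables (A B As Bs : H -> H) (M : H -> Prop).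
Hypothesis hdc : doubly_commuting_on A B As Bs M.

(** Each P = A^m A*^m is selfadjoint, so its fixed vectors form the orthocomplement of the range of
    P - 1. *)
Lemma unitary_part_closed : closed_subspace ip (unitary_part A As M).
Proof.
have [[aA _ _ _] hM _ _ _] := hdc.
have pA m : is_adjoint ip (fun x => iter m A (iter m As x)) (fun x => iter m A (iter m As x)).
  move=> x y; have aAm := iter_adjoint m aA.
  by rewrite aAm -(adjointC aAm).
rewrite (_ : unitary_part A As M = fun x => M x /\
    orth_compl ip (fun y => exists m z, y = iter m A (iter m As z) - z) x).
  exact: (closed_subspaceI hM (orth_compl_closed _)).
apply/funext => x; apply/propext; split=> -[Mx hx]; split=> //.
  by move=> _ [m [z ->]]; rewrite ipBr -pA hx subrr.
move=> m; apply: ip_inj => z; rewrite pA; apply/eqP; rewrite -subr_eq0 -ipBr.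
by apply/eqP/hx; exists m, z.
Qed.

Lemma unitary_part_reducing : reducing A B As Bs (unitary_part A As M).
Proof.
have [[aA aB kA kB] _ [iA iB iAs iBs] hc hd] := hdc.
split=> x [Mx hx]; (split; first by auto) => -[//|m].
- by rewrite [iter m.+1 As _]iterSr kA iterS hx.
- rewrite (iter_comm _ iAs) => // [|y /hd [] //].
  rewrite (@iter_comm _ _ M _ _ iA) ?hx //.
  exact: iter_invariant.
(* Level m+1 for [As x] comes from level m+2 for [x], one factor [A] being cancelled by [As]. *)
- by rewrite -iterSr -[in RHS](hx m.+2) [in RHS]iterS kA.
- rewrite (iter_comm _ iAs) => // [|y _]; last exact: (adjoint_comm _ aA aB hc).
  rewrite (@iter_comm _ _ M _ _ iA) ?hx // => [y /hd [] //|].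
  exact: iter_invariant.
Qed.

Lemma unitary_part_onto y : unitary_part A As M y ->
  exists x, unitary_part A As M x /\ A x = y.
Proof.
move=> hy; have [_ _ h _] := unitary_part_reducing.
by exists (As y); split; [exact: h|have [_ /(_ 1%N)] := hy].
Qed.

Lemma unitary_part_hnorm m x : Defs.isometry ip A -> unitary_part A As M x ->
  hnorm ip (iter m As x) = hnorm ip x.
Proof.
move=> [_ nA] [_ hx]; rewrite -[in RHS](hx m).
by move: (iter m As x) => z; elim: m => //= k ih; rewrite nA.
Qed.

Lemma unitary_part_shift x : Defs.isometry ip A ->
  shift_adj ip (fun x => Bs (As x)) -> unitary_part A As M x ->
  hcvg ip (fun m => iter m Bs x) 0.
Proof.
have [[aA aB _ _] _ _ hc _] := hdc; have [_ _ _ iBs] := unitary_part_reducing.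
move=> nA hs hx e /(hs x) [N hN]; exists N => n /hN; rewrite !subr0.
have -> : iter n (fun x => Bs (As x)) x = iter n As (iter n Bs x).
  elim: n => // n ih; rewrite iterS ih [iter n.+1 Bs x]iterS (@iter_comm As Bs xpredT) //.
  by move=> y _; apply: (adjoint_comm _ aA aB hc).
by rewrite unitary_part_hnorm //; apply: iter_invariant.
Qed.

End UnitaryPart.

(* For w in M with B* w = 0, the vector w - A A* w is killed by A* and B*, so
   w = A A* w, and iterating puts w in the unitary part U of A. Hence B* is
   injective on the orthocomplement of U in M, where B is therefore unitary. *)
Theorem doubly_commuting_shift_unitary (A B As Bs : H -> H) (M : H -> Prop) :
  doubly_commuting_on A B As Bs M -> Defs.isometry ip A -> Defs.isometry ip B ->
  shift_adj ip (fun x => Bs (As x)) ->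
  (forall x, M x -> As x = 0 -> Bs x = 0 -> x = 0) ->
  shift_unitary_on ip A B As Bs M.
Proof.
move=> hdc nA nB hs hker.
have hdc' := doubly_commuting_sym hdc.
have [[aA aB kA kB] hM [iA iB iAs iBs] hc hd] := hdc.
have lA := nA.1; have lB := nB.1.
have lAs := adjoint_hlinear (adjointC aA); have lBs := adjoint_hlinear (adjointC aB).
have hs' : shift_adj ip (fun x => As (Bs x)).
  suff -> : (fun x => As (Bs x)) = (fun x => Bs (As x)) by [].
  by apply/funext => x; apply: (adjoint_comm _ aA aB hc).
have hU := unitary_part_closed hdc; have hU' := unitary_part_closed hdc'.
have rU := unitary_part_reducing hdc; have [rB rA rBs rAs] := unitary_part_reducing hdc'.
have sU x := @unitary_part_shift A B As Bs M hdc x nA hs.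
split; first by move=> x /hd [].
exists (unitary_part A As M), (unitary_part B Bs M); split; last split; last split.
- split=> // [x []//|x []//|x y hx hy].
  (* Since y = B^N B*^N y, <z,y> = <B*^N z, B*^N y>, where |B*^N z| tends to 0 and |B*^N y| =
     |y|. *)
  have r0 z : unitary_part A As M z -> rip z y = 0.
    move=> hz; apply: (@eq0_of_small _ (hnorm ip y)) => e /(sU z hz) [N /(_ N (leqnn N))].
    rewrite subr0 => hN; have aBN := iter_adjoint N aB.
    have -> : rip z y = rip (iter N Bs z) (iter N Bs y).
      by rewrite -{1}(hy.2 N) /rip -(adjointC aBN).
    apply: le_trans (cauchy_schwarz _ _) _.
    by rewrite (unitary_part_hnorm _ nB hy) ler_wpM2r ?hnorm_ge0 // ltW.
  by apply: ip_eq0P; apply: r0 => //; have [_ _ hZ] := hU.1; apply: hZ.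
- move=> x Mx; have [p [hp hxp]] := projection x hU.
  exists p, (x - p); split=> //; last by rewrite addrC subrK.
  move: (subspaceB hM.1 Mx hp.1) hxp; move: (x - p) => z Mz hz.
  have hW w : M w -> Bs w = 0 -> A (As w) = w.
    move=> Mw Bw; apply/eqP; rewrite eq_sym -subr_eq0; apply/eqP/hker.
    + by apply: (subspaceB hM.1) => //; apply/iA/iAs.
    + by rewrite hlinearB // kA subrr.
    + have [h _] := hd _ (iAs _ Mw); rewrite hlinearB // h -(adjoint_comm _ aA aB hc) Bw.
      by rewrite (hlinear0 lAs) (hlinear0 lA) subrr.
  have hWU w : M w -> Bs w = 0 -> unitary_part A As M w.
    move=> Mw Bw; split=> // m; elim: m w Mw Bw => // m ih w Mw Bw.
    rewrite [iter m.+1 As w]iterSr iterS ih ?hW //; first exact: iAs.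
    by rewrite -(adjoint_comm _ aA aB hc) Bw (hlinear0 lAs).
  (* The vector w = y - B B* y is killed by B*, hence lies in the unitary part of [A] and is
     orthogonal to [y]; it is also orthogonal to B B* y, so w = 0. *)
  have BBs y : M y -> orth_compl ip (unitary_part A As M) y -> B (Bs y) = y.
    move=> My hy; have Mw : M (y - B (Bs y)) by apply: (subspaceB hM.1) => //; apply/iB/iBs.
    have Bw : Bs (y - B (Bs y)) = 0 by rewrite hlinearB // kB subrr.
    apply/eqP; rewrite eq_sym -subr_eq0; apply/eqP/ipxx_eq0.
    by rewrite {1}ipBl aB Bw ip0r subr0 hy //; apply: hWU.
  split=> // m; elim: m z Mz hz => // m ih z Mz hz.
  rewrite [iter m.+1 Bs z]iterSr iterS ih ?BBs //; first exact: iBs.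
  by move=> u hu; rewrite (adjointC aB) hz //; have [_ h _ _] := rU; apply: h.
- by split; [exact: rU|split].
- split; [exact: (unitary_part_onto hdc)|exact: sU|exact: (unitary_part_onto hdc')|].
  by move=> x; exact: (unitary_part_shift hdc').
Qed.

(** * Pairs with normal cross-commutator *)

(** Tested against [z] orthogonal to [S]: <T x, z> = <x, T* z>, and T* z is again orthogonal to [S].
    Duality replaces a continuity argument. *)
Lemma cspan_invariant (T Ts : H -> H) (S : H -> Prop) : is_adjoint ip T Ts ->
  (forall x, S x -> cspan ip S (T x)) -> Defs.invariant T (cspan ip S).
Proof.
move=> aT hS x hx; apply/cspanP => z hz; rewrite aT.
by apply: cspan_orth hx => s Ss; rewrite -aT; apply: cspan_orth (hS _ Ss).
Qed.

Lemma orth_compl_invariant (T Ts : H -> H) (S : H -> Prop) : is_adjoint ip T Ts ->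
  Defs.invariant Ts S -> Defs.invariant T (orth_compl ip S).
Proof. by move=> aT iS x hx y /iS Sy; rewrite aT hx. Qed.

Lemma iter_mul_comm (f g : H -> H) m x :
  (forall y, f (g y) = g (f y)) -> iter m f (g x) = g (iter m f x).
Proof. by move=> h; rewrite (@iter_comm f g xpredT). Qed.

(** [commutator V2 V1s] is the adjoint of [commutator V1 V2s], so the last clause is normality; in
    this form the notion is symmetric and each result has its mirror image. *)
Definition normal_pair (V1 V2 V1s V2s : H -> H) : Prop :=
  [/\ is_adjoint ip V1 V1s /\ is_adjoint ip V2 V2s,
      Defs.isometry ip V1 /\ Defs.isometry ip V2,
      (forall x, V1 (V2 x) = V2 (V1 x)) &
      forall x, commutator V1 V2s (commutator V2 V1s x) =
                commutator V2 V1s (commutator V1 V2s x)].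

Lemma normal_pair_sym V1 V2 V1s V2s :
  normal_pair V1 V2 V1s V2s -> normal_pair V2 V1 V2s V1s.
Proof. by case=> -[? ?] [? ?] h1 h2; split. Qed.

Lemma commutator_adjoint V1 V2 V1s V2s :
  is_adjoint ip V1 V1s -> is_adjoint ip V2 V2s ->
  is_adjoint ip (commutator V1 V2s) (commutator V2 V1s).
Proof.
move=> a1 a2 x y; rewrite /commutator ipBl ipBr.
by rewrite (adjointC a2) !a1 (adjointC a2).
Qed.

(** Pairing C x = x with [x] gives |V1* x|^2 + |V2* x|^2 = |V1* V2* x|^2 <= |V2* x|^2. Hence V1* x =
    0, and then the right side vanishes as well. *)
Lemma E1P V1 V2 V1s V2s x :
  is_adjoint ip V1 V1s -> is_adjoint ip V2 V2s ->
  Defs.isometry ip V1 -> Defs.isometry ip V2 -> (forall x, V1 (V2 x) = V2 (V1 x)) ->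
  E1 V1 V2 V1s V2s x <-> V1s x = 0 /\ V2s x = 0.
Proof.
move=> a1 a2 i1 i2 hc; have l1 := i1.1; have l2 := i2.1.
have e1 y z : rip (V1 y) z = rip y (V1s z) by rewrite /rip a1.
have e2 y z : rip (V2 y) z = rip y (V2s z) by rewrite /rip a2.
have contr y : rip (V1s y) (V1s y) <= rip y y.
  have := ripxx_ge0 (y - V1 (V1s y)).
  rewrite !ripE (ripC (V1 (V1s y)) y) !e1 (isometry_adjointK _ i1 a1); lra.
split=> [h|[h1 h2]]; last first.
  rewrite /E1 /defect_op h1 h2 (hlinear0 (adjoint_hlinear (adjointC a1))).
  by rewrite !(hlinear0 l2, hlinear0 l1) !subr0 addr0.
have e : rip (V1s x) (V1s x) + rip (V2s x) (V2s x) = rip (V1s (V2s x)) (V1s (V2s x)).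
  have := congr1 (fun y => rip y x) h; rewrite /defect_op !ripE.
  by rewrite !(e1, e2) -(adjoint_comm x a1 a2 hc); lra.
have h2 := contr (V2s x).
have h1 : V1s x = 0.
  by apply/ripxx_eq0/eqP; rewrite eq_le ripxx_ge0 andbT; lra.
split=> //; apply: ripxx_eq0; move: e.
rewrite (adjoint_comm x a1 a2 hc) h1 (hlinear0 (adjoint_hlinear (adjointC a2))).
by rewrite /rip !ip0l add0r.
Qed.

Section NormalPair.
Variables V1 V2 V1s V2s : H -> H.
Hypothesis hp : normal_pair V1 V2 V1s V2s.

Lemma commutator_range2 x : commutator V1 V2s (V2 x) = 0.
Proof.
have [[_ a2] [_ i2] hc _] := hp.
by rewrite /commutator hc !(isometry_adjointK _ i2 a2) subrr.
Qed.

Lemma commutator_ker1 x : V1s (commutator V1 V2s x) = 0.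
Proof.
have [[a1 a2] [i1 _] hc _] := hp.
rewrite /commutator (hlinearB _ _ (adjoint_hlinear (adjointC a1))).
by rewrite (adjoint_comm _ a1 a2 hc) !(isometry_adjointK _ i1 a1) subrr.
Qed.

End NormalPair.

(* This is where normality enters: it gives X and X* the same kernel. *)
Lemma commutator_range1 V1 V2 V1s V2s x :
  normal_pair V1 V2 V1s V2s -> commutator V1 V2s (V1 x) = 0.
Proof.
move=> hp; have [[a1 a2] _ _ hn] := hp.
apply/(normal_ker (commutator_adjoint a1 a2) hn).
exact: (commutator_range2 (normal_pair_sym hp)).
Qed.

(** Dual to the vanishing of X* on the range of [V2]. *)
Lemma commutator_ker2 V1 V2 V1s V2s x :
  normal_pair V1 V2 V1s V2s -> V2s (commutator V1 V2s x) = 0.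
Proof.
move=> hp; have [[a1 a2] _ _ hn] := hp.
apply: ip_inj => y; rewrite (adjointC a2) (commutator_adjoint a1 a2).
by rewrite (commutator_range1 _ (normal_pair_sym hp)) ip0r ip0l.
Qed.

(** * Reducing subspaces generated by wandering eigenvectors *)

Definition orbit (V1 V2 : H -> H) (f : H) : H -> Prop :=
  fun x => exists m n, x = iter m V1 (iter n V2 f).

(** Both eigenvalue equations are kept, so that exchanging the two isometries preserves the
    notion. *)
Definition wandering_eigenvector (V1 V2 V1s V2s : H -> H) (f : H) : Prop :=
  [/\ V1s f = 0, V2s f = 0 & exists lam,
      commutator V1 V2s f = lam *: f /\ commutator V2 V1s f = conjc lam *: f].

Lemma wandering_eigenvector_sym V1 V2 V1s V2s f :
  wandering_eigenvector V1 V2 V1s V2s f -> wandering_eigenvector V2 V1 V2s V1s f.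
Proof.
by move=> [h1 h2 [lam [e1 e2]]]; split=> //; exists (conjc lam); rewrite conjcK.
Qed.

Lemma orbit_sym V1 V2 f x : (forall x, V1 (V2 x) = V2 (V1 x)) ->
  orbit V1 V2 f x -> orbit V2 V1 f x.
Proof.
move=> hc [m [n ->]]; exists n, m.
apply: iter_mul_comm => y; apply/esym/iter_mul_comm => z; exact/esym/hc.
Qed.

Lemma orbit_ip_eq0 V1 V2 V1s V2s f z :
  is_adjoint ip V1 V1s -> is_adjoint ip V2 V2s ->
  (forall m n, ip f (iter n V2s (iter m V1s z)) = 0) ->
  forall g, orbit V1 V2 f g -> ip g z = 0.
Proof.
by move=> a1 a2 hz g [m [n ->]]; rewrite (iter_adjoint m a1) (iter_adjoint n a2).
Qed.

Section Orbit.
Variables (V1 V2 V1s V2s : H -> H) (f : H).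
Hypotheses (hp : normal_pair V1 V2 V1s V2s)
  (hf : wandering_eigenvector V1 V2 V1s V2s f).

Lemma orbit_V1 x : orbit V1 V2 f x -> orbit V1 V2 f (V1 x).
Proof. by move=> [m [n ->]]; exists m.+1, n. Qed.

Lemma orbit_V1s x : orbit V1 V2 f x -> cspan ip (orbit V1 V2 f) (V1s x).
Proof.
have [[a1 a2] [i1 _] _ _] := hp; have [h1 _ [lam [_ h2]]] := hf.
have [[c0 _ cZ] _] := cspan_closed (orbit V1 V2 f).
have V1s_V2 y : V1s (V2 y) = V2 (V1s y) + commutator V2 V1s y.
  by rewrite /commutator addrC subrK.
move=> [[|m] [n ->]] /=; last first.
  by rewrite (isometry_adjointK _ i1 a1); apply: cspan_mem; exists m, n.
case: n => [|n] /=; first by rewrite h1.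
(* X* kills the range of [V2], so in V1* V2 = V2 V1* + X* its only contribution is X* f, at n =
   0. *)
have -> : V1s (V2 (iter n V2 f)) = conjc lam *: iter n V2 f.
  elim: n => [|n ih]; rewrite V1s_V2.
    by rewrite /= h1 h2 (hlinear0 (adjoint_hlinear a2)) add0r.
  rewrite iterS ih (commutator_range1 _ (normal_pair_sym hp)) addr0.
  by rewrite (hlinearZ _ _ (adjoint_hlinear a2)).
by apply/cZ/cspan_mem; exists 0%N, n.
Qed.

End Orbit.

Section WanderingEigenvector.
Variables (V1 V2 V1s V2s : H -> H) (f : H).
Hypotheses (hp : normal_pair V1 V2 V1s V2s)
  (hf : wandering_eigenvector V1 V2 V1s V2s f).

Lemma orbit_span_reducing : reducing V1 V2 V1s V2s (cspan ip (orbit V1 V2 f)).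
Proof.
have [[a1 a2] _ hc _] := hp; have hc' x := esym (hc x).
have eqS : orbit V1 V2 f = orbit V2 V1 f.
  by apply/funext => x; apply/propext; split; apply: orbit_sym.
have hp' := normal_pair_sym hp; have hf' := wandering_eigenvector_sym hf.
split.
- by apply: (cspan_invariant a1) => x hx; apply/cspan_mem/orbit_V1.
- by rewrite eqS; apply: (cspan_invariant a2) => x hx; apply/cspan_mem/orbit_V1.
- by apply: (cspan_invariant (adjointC a1)) => x; apply: (orbit_V1s hp hf).
- by rewrite eqS; apply: (cspan_invariant (adjointC a2)) => x; apply: (orbit_V1s hp' hf').
Qed.

(** Moved across the product, V1^m V2^n becomes V2*^n V1*^m, which kills [z] unless m = n = 0. *)
Lemma orbit_ker_orth z : V1s z = 0 -> V2s z = 0 -> ip f z = 0 ->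
  forall x, cspan ip (orbit V1 V2 f) x -> ip x z = 0.
Proof.
move=> h1 h2 fz x; have [[a1 a2] _ _ _] := hp.
have z1 := hlinear0 (adjoint_hlinear (adjointC a1)).
have z2 := hlinear0 (adjoint_hlinear (adjointC a2)).
have it0 (T : H -> H) k : T 0 = 0 -> iter k T 0 = 0 by move=> T0; elim: k => //= k ->.
apply: cspan_orth; apply: (orbit_ip_eq0 a1 a2) => -[|m] n.
  by case: n => // n; rewrite iterSr /= h2 it0 // ip0r.
by rewrite [iter m.+1 V1s z]iterSr h1 (it0 V1s) // it0 // ip0r.
Qed.

Lemma orbit_reducing_orth (N : H -> Prop) : reducing V1 V2 V1s V2s N ->
  (forall y, N y -> ip f y = 0) ->
  forall x y, cspan ip (orbit V1 V2 f) x -> N y -> ip x y = 0.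
Proof.
move=> [_ _ i1 i2] hN x y hx Ny; have [[a1 a2] _ _ _] := hp.
apply: cspan_orth hx; apply: (orbit_ip_eq0 a1 a2) => m n; apply: hN.
by apply: iter_invariant => //; apply: iter_invariant.
Qed.

(* The projection of f to a reducing subspace N of the span is again wandering,
   hence a multiple of f. *)
Lemma orbit_span_irreducible : ip f f = 1 ->
  irreducible_on ip V1 V2 V1s V2s (cspan ip (orbit V1 V2 f)).
Proof.
move=> f1 N hN NM rN; have [[a1 a2] _ _ _] := hp; have [i1 i2 i1s i2s] := rN.
have [w1 w2 _] := hf.
have [p [Np hp']] := projection f hN.
(* As T T* p lies in [N], <T* p, T* p> = <p, T T* p> = <f, T T* p> = <T* f, T* p> = 0. *)
have ker (T Ts : H -> H) : is_adjoint ip T Ts -> Defs.invariant T N ->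
    Defs.invariant Ts N -> Ts f = 0 -> Ts p = 0.
  move=> aT iT iTs Tf; apply: ipxx_eq0; rewrite (adjointC aT).
  have : ip (f - p) (T (Ts p)) = 0 by apply/hp'/iT/iTs.
  rewrite ipBl -(adjointC aT) Tf ip0l => /eqP.
  by rewrite sub0r oppr_eq0 => /eqP.
have p1 := ker _ _ a1 i1 i1s w1; have p2 := ker _ _ a2 i2 i2s w2.
have l1 := adjoint_hlinear (adjointC a1); have l2 := adjoint_hlinear (adjointC a2).
have hS := cspan_closed (orbit V1 V2 f).
have Sf : cspan ip (orbit V1 V2 f) f by apply: cspan_mem; exists 0%N, 0%N.
pose q := p - ip p f *: f.
have q0 : q = 0.
  apply: ipxx_eq0; apply: orbit_ker_orth.
  - by rewrite /q (hlinearB _ _ l1) (hlinearZ _ _ l1) p1 w1 scaler0 subr0.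
  - by rewrite /q (hlinearB _ _ l2) (hlinearZ _ _ l2) p2 w2 scaler0 subr0.
  - by apply: ip_eq0C; rewrite /q ipBl ipZl f1 mulr1 subrr.
  - by apply: (subspaceB hS.1 (NM _ Np)); have [_ _ hZ] := hS.1; apply: hZ.
have pE : p = ip p f *: f by apply/eqP; rewrite -subr_eq0; apply/eqP.
(* If p = 0 then [f] is orthogonal to [N], so its whole orbit span is, and that span contains [N];
   otherwise [N] contains [f] and thus the span. *)
have [c0|cn] := eqVneq (ip p f) 0; [left=> x Nx|right].
  apply: ipxx_eq0; apply: (orbit_reducing_orth rN) => // [y Ny|]; last exact: NM.
  by have := hp' _ Ny; rewrite pE c0 scale0r subr0.
have Nf : N f.
  have [_ _ NZ] := hN.1; have := NZ (ip p f)^-1 _ Np.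
  by rewrite {2}pE scalerA mulVf // scale1r.
apply: (cspan_min hN) => x [m [n ->]].
by apply: iter_invariant => //; apply: iter_invariant.
Qed.

End WanderingEigenvector.
End InnerProduct.

(** * Assembling the decomposition of a compact normal pair *)

Theorem theorem8p9 (R : realType) (H : lmodType R[i]) (ip : H -> H -> R[i])
    (V1 V2 V1s V2s : H -> H) :
  hilbert_space ip ->
  is_adjoint ip V1 V1s -> is_adjoint ip V2 V2s ->
  compact_normal_pair ip V1 V2 V1s V2s ->
  exists (J : nat -> Prop) (f : nat -> H),
    orthonormal_basis ip J f (E1 V1 V2 V1s V2s) /\
    (forall j, J j -> exists lam : R[i], commutator V1 V2s (f j) = lam *: f j) /\
    let Hj := fun j => cspan ip (fun x => exists m n, x = iter m V1 (iter n V2 (f j))) in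
    let H0 := orth_compl ip (cspan ip (fun x => exists j, J j /\ Hj j x)) in
    (* (1) *)
    (closed_subspace ip H0 /\ reducing V1 V2 V1s V2s H0) /\
    (forall j, J j -> closed_subspace ip (Hj j) /\ reducing V1 V2 V1s V2s (Hj j)) /\
    (forall j j', J j -> J j' -> j <> j' -> horth ip (Hj j) (Hj j')) /\
    (forall j, J j -> horth ip H0 (Hj j)) /\
    (forall x, cspan ip (fun y => H0 y \/ exists j, J j /\ Hj j y) x) /\
    (* (2) *)
    (forall j, J j -> irreducible_on ip V1 V2 V1s V2s (Hj j)) /\
    (* (3) *)
    shift_unitary_on ip V1 V2 V1s V2s H0.
Proof.
move=> [hip hcomplete hsep] a1 a2 [[i1 i2 hc hshift] [bX cX] [Ts [aT nT]]].
have aX := commutator_adjoint hip a1 a2.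
(* Uniqueness of adjoints identifies the adjoint supplied by normality with [V1*, V2]. *)
have Tseq x : Ts x = commutator V2 V1s x := adjoint_unique hip x aT aX.
have nX x : commutator V1 V2s (commutator V2 V1s x) =
            commutator V2 V1s (commutator V1 V2s x) by rewrite -!Tseq.
have hp : normal_pair ip V1 V2 V1s V2s by [].
have hp' := normal_pair_sym hp.
have E1E x := E1P hip x a1 a2 i1 i2 hc.
have hE1 : closed_subspace ip (E1 V1 V2 V1s V2s).
  rewrite (_ : E1 V1 V2 V1s V2s = fun x => V1s x = 0 /\ V2s x = 0); last first.
    by apply/funext => x; apply/propext.
  apply: closed_subspaceI; first exact: (ker_closed hip (adjointC hip a1)).
  exact: (ker_closed hip (adjointC hip a2)).
have XE x : E1 V1 V2 V1s V2s (commutator V1 V2s x).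
  by apply/E1E; split; [exact: (commutator_ker1 hip hp)|exact: (commutator_ker2 hip x hp)].
have XsE x : E1 V1 V2 V1s V2s (commutator V2 V1s x).
  by apply/E1E; split; [exact: (commutator_ker2 hip x hp')|exact: (commutator_ker1 hip hp')].
have [J [f [hJf heig]]] := compact_normal_eigenbasis hip hcomplete bX cX aX nX hsep
  hE1 (fun x _ => XE x) (fun x _ => XsE x).
have [fE fon fspan] := hJf.
exists J, f; split=> //; split; first by move=> j /heig [lam [? _]]; exists lam.
have wf j : J j -> wandering_eigenvector V1 V2 V1s V2s (f j).
  by move=> Jj; have /E1E [? ?] := fE _ Jj; split=> //; apply: heig.
move=> Hj H0.
have rHj j : J j -> reducing V1 V2 V1s V2s (Hj j).
  by move=> /wf hw; exact: (orbit_span_reducing hip hcomplete hp hw).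
have fHj j : Hj j (f j) by apply: (cspan_mem hip); exists 0%N, 0%N.
pose U x := exists j, J j /\ Hj j x.
have HjU j x : J j -> Hj j x -> cspan ip U x.
  by move=> Jj hx; apply: (cspan_mem hip); exists j.
have rU : reducing V1 V2 V1s V2s (cspan ip U).
  split; [apply: (cspan_invariant hip hcomplete a1)|apply: (cspan_invariant hip hcomplete a2)
    |apply: (cspan_invariant hip hcomplete (adjointC hip a1))
    |apply: (cspan_invariant hip hcomplete (adjointC hip a2))] => x [j [Jj hx]];
    have [r1 r2 r3 r4] := rHj j Jj; apply: (HjU j) => //;
    by [apply: r1|apply: r2|apply: r3|apply: r4].
have hH0 : closed_subspace ip H0 := orth_compl_closed hip _.
have rH0 : reducing V1 V2 V1s V2s H0.
  have [u1 u2 u1s u2s] := rU.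
  by split; [exact: (orth_compl_invariant a1)|exact: (orth_compl_invariant a2)
    |exact: (orth_compl_invariant (adjointC hip a1))|exact: (orth_compl_invariant (adjointC hip a2))].
have H0Hj j : J j -> horth ip H0 (Hj j) by move=> Jj x y hx hy; apply/hx/(HjU j).
(* [E1] is the closed span of the [f j], each of which lies in [Hj j] and so is orthogonal to
   [H0]. *)
have E1H0 x : E1 V1 V2 V1s V2s x -> H0 x -> x = 0.
  move=> /fspan hx Hx; apply: (ipxx_eq0 hip); apply: (cspan_orth hip _ hx) => _ [j [Jj ->]].
  by apply: (ip_eq0C hip); apply: (H0Hj j).
split; first by [].
split; first by move=> j Jj; split; [exact: (cspan_closed hip)|exact: rHj].
split.
  move=> j j' Jj Jj' jj' x y hx hy.
  apply: (orbit_reducing_orth hip hp (rHj _ Jj') _ hx hy) => z hz.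
  apply: (ip_eq0C hip); have /E1E [w1 w2] := fE _ Jj.
  apply: (orbit_ker_orth hip hp w1 w2 _ hz).
  by rewrite fon //; case: eqP => // e; case: jj'.
split; first by [].
split.
  (* A vector [z] orthogonal to every [Hj j] lies in [H0]; orthogonal to [H0] too, it is orthogonal
     to itself. *)
  move=> x; apply/(cspanP hip hcomplete) => z hz.
  suff -> : z = 0 by rewrite (ip0r hip).
  apply: (ipxx_eq0 hip); apply: (hz z); left=> y hy.
  by apply: (ip_eq0C hip); apply: (cspan_orth hip _ hy) => s Us; apply: hz; right.
split.
  move=> j Jj; apply: (orbit_span_irreducible hip hcomplete hp (wf _ Jj)).
  by rewrite fon // eqxx.
(* X x lies in [E1] for every [x], and in [H0] because [H0] is reducing. *)
have X0 x : H0 x -> commutator V1 V2s x = 0.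
  move=> hx; apply: E1H0 => //; have [r1 r2 r1s r2s] := rH0.
  by apply: (subspaceB hH0.1); [apply/r2s/r1|apply/r1/r2s].
apply: (doubly_commuting_shift_unitary hip hcomplete) => //; last first.
  by move=> x hx h1 h2; apply: E1H0 => //; apply/E1E.
split=> //.
  split=> // x; first exact: (isometry_adjointK hip _ i1 a1).
  exact: (isometry_adjointK hip _ i2 a2).
move=> x hx; have x0 := X0 x hx; have xs0 := (normal_ker hip aX nX x).1 x0.
by split; apply/eqP; rewrite -subr_eq0; apply/eqP.
Qed.
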